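(* The classes of Boolean functions that are $\mathsf{L}_c$-stable or, equivalently, the classes of Boolean functions that are $(\mathsf{I}_c,\mathsf{L}_c)$-stable, are exactly the following: \begin{align*} & \Omega, && \Omega_{a*}, && \Omega_{*b}, && \Omega_{\approx}, && \Omega_{ab}, \\ & \mathsf{D}_k, && \mathsf{D}_k\cap\Omega_{a*}, && \mathsf{D}_k\cap\Omega_{*b}, && \mathsf{D}_k\cap\Omega_{\approx}, && \mathsf{D}_k\cap\Omega_{ab}, \\ & \mathsf{X}_k, && \mathsf{X}_k\cap\Omega_{a*}, && \mathsf{X}_k\cap\Omega_{*b}, && \mathsf{X}_k\cap\Omega_{\approx}, && \mathsf{X}_k\cap\Omega_{ab}, \\ & \mathsf{D}_i\cap\mathsf{X}_j, && \mathsf{D}_i\cap\mathsf{X}_j\cap\Omega_{a*}, && \mathsf{D}_i\cap\mathsf{X}_j\cap\Omega_{*b}, && \mathsf{D}_i\cap\mathsf{X}_j\cap\Omega_{\approx}, && \mathsf{D}_i\cap\mathsf{X}_j\cap\Omega_{ab}, \\ & \mathsf{D}_0, && \mathsf{D}_0\cap\Omega_{a*}, && \emptyset, \end{align*} for $a,b\in\{0,1\}$, $\mathord{\approx}\in\{\mathord{=},\mathord{\neq}\}$, and $i,j,k\in\{1,2,3,\dots\}$ with $i>j\geq 1$.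
   Context: A Boolean function is a map $f\colon\{0,1\}^n\to\{0,1\}$ with $n\geq 1$ (its arity); $\Omega$ is the set of all Boolean functions. For $f$ of arity $n$ and $g_1,\dots,g_n$ all of arity $m$, the composition $f(g_1,\dots,g_n)$ is the $m$-ary function $\mathbf{x}\mapsto f(g_1(\mathbf{x}),\dots,g_n(\mathbf{x}))$. For classes $C,K\subseteq\Omega$, $CK:=\{f(g_1,\dots,g_n)\mid f\in C\ n\text{-ary},\ g_1,\dots,g_n\in K\ \text{all } m\text{-ary},\ n,m\geq 1\}$. A clone is a class $C\subseteq\Omega$ containing all projections with $CC\subseteq C$. For clones $C_1,C_2$, a class $K\subseteq\Omega$ is $(C_1,C_2)$-stable if $KC_1\subseteq K$ and $C_2K\subseteq K$; $C$-stable means $(C,C)$-stable. Every $n$-ary Boolean function has a unique multilinear (Zhegalkin) polynomial over $\mathrm{GF}(2)$, $f=\sum_{S\in M_f}\prod_{i\in S}x_i$ with $M_f\subseteq\mathcal{P}(\{1,\dots,n\})$. $\deg(f):=\max_{S\in M_f}|S|$ for $f\neq 0$, $\deg(0):=0$. For $k\in\{0,1,2,\dots\}$, $\mathsf{D}_k:=\{f\in\Omega\mid\deg(f)\leq k\}$. For $S\subseteq\{1,\dots,n\}$, the characteristic of $S$ in $f$ is $\mathrm{ch}(S,f):=|\{A\in M_f\mid S\subsetneq A\}|\bmod 2$. The characteristic rank $\chi(f)$ is the smallest nonnegative integer $m$ such that $\mathrm{ch}(S,f)=0$ for all $S\subseteq\{1,\dots,n\}$ with $|S|\geq m$. $\mathsf{X}_k:=\{f\in\Omega\mid\chi(f)\leq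 k\}$. For $a,b\in\{0,1\}$: $\Omega_{a*}:=\{f\mid f(0,\dots,0)=a\}$, $\Omega_{*b}:=\{f\mid f(1,\dots,1)=b\}$, $\Omega_{ab}:=\Omega_{a*}\cap\Omega_{*b}$; $\Omega_{=}:=\{f\mid f(0,\dots,0)=f(1,\dots,1)\}$, $\Omega_{\neq}:=\{f\mid f(0,\dots,0)\neq f(1,\dots,1)\}$; $\Omega_\approx$ denotes one of the latter two. $\mathsf{I}_c$ is the clone of all projections, and $\mathsf{L}_c:=\mathsf{D}_1\cap\Omega_{01}$ is the clone of idempotent linear functions (the clone generated by $x_1+x_2+x_3$). *)

(* Defs.v *)
From mathcomp Require Import all_boot all_algebra.
From mathcomp Require Import classical_sets.

Set Implicit Arguments.
Unset Strict Implicit.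
Unset Printing Implicit Defensive.

Import GRing.Theory.

(* MathComp equips bool with its field structure GF(2): in ring_scope, + is
   addb and * is andb. *)

Notation bvec n := {ffun 'I_n -> bool}.
Notation bfun n := {ffun bvec n -> bool}.

Definition zhegalkin n (M : {set {set 'I_n}}) : bfun n :=
  [ffun x : bvec n => (\sum_(S in M) \prod_(i in S) x i)%R].

Lemma zhegalkin_ind n (M : {set {set 'I_n}}) (S : {set 'I_n}) :
  zhegalkin M [ffun i => i \in S]
    = (\sum_(A in M | A \subset S) (1 : bool))%R.
Proof.
rewrite ffunE [RHS]big_mkcondr; apply: eq_bigr => A _.
case: ifP => [/fintype.subsetP sAS | /negbT /fintype.subsetPn[i iA iNS]].
  by rewrite big1 // => i iA; rewrite ffunE sAS.
by rewrite (bigD1 i) //= ffunE (negbTE iNS) mul0r.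
Qed.

Lemma zhegalkin_inj n : injective (@zhegalkin n).
Proof.
move=> M N eqMN; apply/setP => S.
have [m] := ubnP #|S|; elim: m S => // m IHm S; rewrite ltnS => leSm.
have:= zhegalkin_ind M S; rewrite eqMN zhegalkin_ind.
have split (P : {set {set 'I_n}}) : (\sum_(A in P | A \subset S) (1 : bool)
    = (S \in P) + \sum_(A in P | A \proper S) (1 : bool))%R.
  rewrite big_mkcond (bigD1 S) //= subxx andbT -big_mkcondr /=.
  congr (_ + _)%R; first by case: ifP.
  rewrite big_mkcond [RHS]big_mkcond /=; apply: eq_bigr => A _.
  rewrite finset.properEneq.
  by case: (A \in P) => //=; case: eqP => //=; case: (_ \subset _).
rewrite !split.
have -> : (\sum_(A in N | A \proper S) (1 : bool)
         = \sum_(A in M | A \proper S) (1 : bool))%R.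
  apply: eq_bigl => A; have [pAS | _] := boolP (A \proper S).
    by rewrite !andbT IHm // (leq_trans (proper_card pAS)).
  by rewrite !andbF.
by move/addIr => ->.
Qed.

Lemma zhegalkin_exists n (f : bfun n) : exists M, zhegalkin M = f.
Proof.
have card_eq : #|{: bfun n}| <= #|{: {set {set 'I_n}}}|.
  by rewrite card_ffun card_bool card_ffun card_bool card_ord
             -[#|{: {set {set _}}}|]cardsT -powersetT card_powerset
             cardsT -[#|{: {set _}}|]cardsT -powersetT card_powerset
             cardsT card_ord.
have [g _ gK] := inj_card_bij (@zhegalkin_inj n) card_eq.
by exists (g f); rewrite gK.
Qed.

(* By monomialsK and zhegalkin_inj, this is the unique M such
   that zhegalkin M = f; the default is never used. *)
Definition monomials n (f : bfun n) : {set {set 'I_n}} :=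
  odflt finset.set0 [pick M | zhegalkin M == f].

Lemma monomialsK n (f : bfun n) : zhegalkin (monomials f) = f.
Proof.
rewrite /monomials; case: pickP => [M /eqP // | nof].
by have [M Mf] := zhegalkin_exists f; have /eqP[] := nof M.
Qed.

(* The maximum over the empty set is 0, so that deg of the zero function is 0. *)
Definition deg n (f : bfun n) : nat := \max_(S in monomials f) #|S|.

Definition ch n (S : {set 'I_n}) (f : bfun n) : bool :=
  odd #|[set A in monomials f | S \proper A]|.

Definition ch_vanishes_from n (f : bfun n) (m : nat) : bool :=
  [forall S : {set 'I_n}, (m <= #|S|) ==> ~~ ch S f].

Lemma ch_vanishes_exists n (f : bfun n) : exists m, ch_vanishes_from f m.
Proof.
exists n; apply/forallP => S; apply/implyP => leS.
rewrite /ch eq_card0 // => A; rewrite inE; apply/negP => /andP[_].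
by move/proper_card; rewrite ltnNge (leq_trans _ leS) // -[n in _ <= n]card_ord max_card.
Qed.

Definition chi n (f : bfun n) : nat := ex_minn (ch_vanishes_exists f).

Local Open Scope classical_set_scope.

(* The tag n of a Boolean function stands for the arity n.+1, so that arities
   are positive. *)
Definition boolfun : Type := {n : nat & bfun n.+1}.

Definition Bf n (f : bfun n.+1) : boolfun := Tagged (fun n => bfun n.+1) f.

Definition bcomp n m (f : bfun n) (g : 'I_n -> bfun m) : bfun m :=
  [ffun x => f [ffun i => g i x]].

Definition class_comp (C K : set boolfun) : set boolfun :=
  [set h | exists (n m : nat) (f : bfun n.+1) (g : 'I_n.+1 -> bfun m.+1),
     [/\ C (Bf f), forall i, K (Bf (g i)) & h = Bf (bcomp f g)]].

Definition stable2 (C1 C2 K : set boolfun) : Prop :=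
  class_comp K C1 `<=` K /\ class_comp C2 K `<=` K.

Definition stable (C K : set boolfun) : Prop := stable2 C C K.

Definition Omega : set boolfun := setT.

Definition at_zeros (f : boolfun) : bool := tagged f [ffun=> false].
Definition at_ones (f : boolfun) : bool := tagged f [ffun=> true].

Definition Omega_l (a : bool) : set boolfun := [set f | at_zeros f = a].
Definition Omega_r (b : bool) : set boolfun := [set f | at_ones f = b].
Definition Omega_lr (a b : bool) : set boolfun := Omega_l a `&` Omega_r b.
Definition Omega_eq : set boolfun := [set f | at_zeros f = at_ones f].
Definition Omega_neq : set boolfun := [set f | at_zeros f <> at_ones f].

Variant approx := ApproxEq | ApproxNeq.

Definition Omega_approx (r : approx) : set boolfun :=
  match r with ApproxEq => Omega_eq | ApproxNeq => Omega_neq end.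

Definition D (k : nat) : set boolfun := [set f | (deg (tagged f) <= k)%N].
Definition X (k : nat) : set boolfun := [set f | (chi (tagged f) <= k)%N].

Definition proj n (i : 'I_n) : bfun n := [ffun x : bvec n => x i].

Definition Ic : set boolfun :=
  [set f | exists (n : nat) (i : 'I_n.+1), f = Bf (proj i)].
Definition Lc : set boolfun := D 1 `&` Omega_lr false true.

Inductive listed_class : set boolfun -> Prop :=
| LC_Omega : listed_class Omega
| LC_Omega_l a : listed_class (Omega_l a)
| LC_Omega_r b : listed_class (Omega_r b)
| LC_Omega_approx r : listed_class (Omega_approx r)
| LC_Omega_lr a b : listed_class (Omega_lr a b)
| LC_D k : (1 <= k)%N -> listed_class (D k)
| LC_D_l k a : (1 <= k)%N -> listed_class (D k `&` Omega_l a)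
| LC_D_r k b : (1 <= k)%N -> listed_class (D k `&` Omega_r b)
| LC_D_approx k r : (1 <= k)%N -> listed_class (D k `&` Omega_approx r)
| LC_D_lr k a b : (1 <= k)%N -> listed_class (D k `&` Omega_lr a b)
| LC_X k : (1 <= k)%N -> listed_class (X k)
| LC_X_l k a : (1 <= k)%N -> listed_class (X k `&` Omega_l a)
| LC_X_r k b : (1 <= k)%N -> listed_class (X k `&` Omega_r b)
| LC_X_approx k r : (1 <= k)%N -> listed_class (X k `&` Omega_approx r)
| LC_X_lr k a b : (1 <= k)%N -> listed_class (X k `&` Omega_lr a b)
| LC_DX i j : (1 <= j < i)%N -> listed_class (D i `&` X j)
| LC_DX_l i j a : (1 <= j < i)%N -> listed_class (D i `&` X j `&` Omega_l a)
| LC_DX_r i j b : (1 <= j < i)%N -> listed_class (D i `&` X j `&` Omega_r b)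
| LC_DX_approx i j r :
    (1 <= j < i)%N -> listed_class (D i `&` X j `&` Omega_approx r)
| LC_DX_lr i j a b :
    (1 <= j < i)%N -> listed_class (D i `&` X j `&` Omega_lr a b)
| LC_D0 : listed_class (D 0)
| LC_D0_l a : listed_class (D 0 `&` Omega_l a)
| LC_empty : listed_class set0.

(* Main.v *)
(* Write [delta f = f + f o negv], where [negv] negates every variable.  The
   monomials of [delta f] are the sets of odd characteristic in [f], so that
   [chi f <= k.+1] iff [deg (delta f) <= k].  Stability of the listed classes follows,
   since idempotent linear functions commute with [negv] and are additive.

   Conversely, if K is nonempty and stable under minors and triple sums, the
   differences of members of K that vanish at 0...0 and 1...1 form a space V closed
   under sums and minors, and f is in K iff some member of K has the same values at
   0...0 and 1...1 and f + (unary function with these values) is in V.  If V contains a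
   function of degree d, it contains all products of at most d (and at least one)
   factors [x_i + x_0], which span the functions h of degree at most d with
   [delta h = 0] and [h 0...0 = 0].  Applying this to V and to the space [delta V]
   shows that V is determined by the maximal degrees of V and [delta V]. *)

Require Import Defs.
From mathcomp Require Import all_boot all_algebra.
From mathcomp Require Import boolp classical_sets.

Set Implicit Arguments.
Unset Strict Implicit.
Unset Printing Implicit Defensive.

Import GRing.Theory.
Local Open Scope ring_scope.

(** * Coefficients of Zhegalkin polynomials *)

Lemma addr_self (b : bool) : b + b = 0.
Proof. exact: addbb. Qed.

Lemma bfun_addff n (f : bfun n) : f + f = 0.
Proof. by apply/ffunP => x; rewrite !ffunE; case: (f x). Qed.

Lemma bfun_addfK n (g f : bfun n) : f + g + g = f.
Proof. by rewrite -addrA bfun_addff addr0. Qed.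

(** Summing over all subsets with a 0/1 coefficient lets two polynomials be added term by term. *)
Lemma zhegalkinE n (M : {set {set 'I_n}}) (x : bvec n) :
  zhegalkin M x = \sum_S (S \in M) * \prod_(i in S) x i.
Proof.
by rewrite ffunE big_mkcond; apply: eq_bigr => S _; case: ifP.
Qed.

Lemma prod_boolE (I : finType) (A : {pred I}) (F : I -> bool) :
  \prod_(i in A) F i = [forall (i | i \in A), F i].
Proof. exact: big_andE. Qed.

Lemma monomials_zhegalkin n (M : {set {set 'I_n}}) : monomials (zhegalkin M) = M.
Proof. by apply: zhegalkin_inj; rewrite monomialsK. Qed.

Lemma bfun_zhegalkin n (f : bfun n) (x : bvec n) :
  f x = \sum_(S in monomials f) \prod_(i in S) x i.
Proof. by rewrite -{1}(monomialsK f) ffunE. Qed.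

(** By uniqueness of the Zhegalkin polynomial, it suffices to evaluate the polynomial with the
    summed coefficients. *)
Lemma monomialsD n (f g : bfun n) (S : {set 'I_n}) :
  (S \in monomials (f + g)) = (S \in monomials f) + (S \in monomials g).
Proof.
suff -> : f + g = zhegalkin
    (finset (fun S => (S \in monomials f) + (S \in monomials g))).
  by rewrite monomials_zhegalkin inE.
apply/ffunP => x; rewrite zhegalkinE ffunE -{1}(monomialsK f) -{1}(monomialsK g).
rewrite !zhegalkinE -big_split; apply: eq_bigr => A _.
by rewrite inE mulrDl.
Qed.

Lemma monomials0 n : monomials (0 : bfun n) = finset.set0.
Proof.
rewrite -[RHS]monomials_zhegalkin; congr monomials.
by apply/ffunP => x; rewrite !ffunE big_set0.
Qed.

Lemma set0_in_monomials n (f : bfun n) :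
  (finset.set0 \in monomials f) = f [ffun=> false].
Proof.
rewrite bfun_zhegalkin.
have [|] := boolP (_ \in _) => f0.
  rewrite (bigD1 finset.set0) //= big_set0 big1 // => S /andP[_ /set0Pn[i iS]].
  by rewrite (bigD1 i) //= ffunE mul0r.
rewrite big1 // => S Sf; have /set0Pn[i iS] : S != finset.set0.
  by apply: contraNneq f0 => <-.
by rewrite (bigD1 i) //= ffunE mul0r.
Qed.

(** * Degree under sums, products and composition *)

Lemma deg_leP n (f : bfun n) (d : nat) :
  reflect (forall S, S \in monomials f -> (#|S| <= d)%N) (deg f <= d)%N.
Proof. exact: bigmax_leqP. Qed.

Lemma deg0 n : deg (0 : bfun n) = 0%N.
Proof. by rewrite /deg monomials0 big_set0. Qed.

Lemma degD_le n (f g : bfun n) (d : nat) :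
  (deg f <= d)%N -> (deg g <= d)%N -> (deg (f + g)%R <= d)%N.
Proof.
move=> /deg_leP df /deg_leP dg; apply/deg_leP => S; rewrite monomialsD.
by have [/df //|_] := boolP (S \in monomials f); rewrite add0r => /dg.
Qed.

Lemma deg_sum_le n (I : Type) (r : seq I) (P : pred I) (F : I -> bfun n) d :
  (forall i, P i -> (deg (F i) <= d)%N) -> (deg (\sum_(i <- r | P i) F i)%R <= d)%N.
Proof.
move=> dF; elim/big_rec: _ => [|i f Pi df]; first by rewrite deg0.
by apply: degD_le => //; apply: dF.
Qed.

Lemma deg_monomial n (A : {set 'I_n}) :
  (deg [ffun x : bvec n => \prod_(i in A) x i]%R <= #|A|)%N.
Proof.
have -> : [ffun x : bvec n => \prod_(i in A) x i] = zhegalkin [set A]%SET.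
  by apply/ffunP => x; rewrite !ffunE big_set1.
by apply/deg_leP => S; rewrite monomials_zhegalkin inE => /eqP->.
Qed.

(** Variables are idempotent, so the monomials of [A] and [B] multiply to the monomial of
    [A :|: B]. *)
Lemma degM_le n (f g : bfun n) a b : (deg f <= a)%N -> (deg g <= b)%N ->
  (deg [ffun x => f x * g x]%R <= a + b)%N.
Proof.
move=> /deg_leP df /deg_leP dg.
have -> : [ffun x => f x * g x] =
    \sum_(A in monomials f) \sum_(B in monomials g)
      [ffun x : bvec n => \prod_(i in A :|: B) x i].
  apply/ffunP => x; rewrite !ffunE sum_ffunE (bfun_zhegalkin f) big_distrl.
  apply: eq_bigr => A _; rewrite sum_ffunE (bfun_zhegalkin g) big_distrr.
  apply: eq_bigr => B _; rewrite ffunE !prod_boolE.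
  apply/andP/forall_inP => [[/forall_inP hA /forall_inP hB] i|h].
    by rewrite inE => /orP[/hA|/hB].
  by split; apply/forall_inP => i iX; apply: h; rewrite inE iX ?orbT.
apply: deg_sum_le => A /df dA; apply: deg_sum_le => B /dg dB.
apply: leq_trans (deg_monomial _) _; apply: leq_trans (leq_card_setU _ _) _.
exact: leq_add.
Qed.

Lemma deg_prod_le n (I : Type) (s : seq I) (g : I -> bfun n) b :
  (forall i, deg (g i) <= b)%N ->
  (deg [ffun x => \prod_(i <- s) g i x]%R <= size s * b)%N.
Proof.
move=> dg; elim: s => [|i s IHs].
  apply: leq_trans (_ : (#|(finset.set0 : {set 'I_n})| <= _)%N); last by rewrite cards0.
  apply: leq_trans (deg_monomial _); rewrite leq_eqVlt; apply/orP; left.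
  by apply/eqP; congr deg; apply/ffunP => x; rewrite !ffunE big_nil big_set0.
rewrite mulSn; have := degM_le (dg i) IHs; congr (deg _ <= _)%N.
by apply/ffunP => x; rewrite !ffunE big_cons.
Qed.

(** Substitution turns each monomial of [f] into a product of at most [a] functions of degree at
    most [b]. *)
Lemma deg_bcomp_le n m (f : bfun n) (g : 'I_n -> bfun m) a b :
  (deg f <= a)%N -> (forall i, deg (g i) <= b)%N -> (deg (bcomp f g) <= a * b)%N.
Proof.
move=> /deg_leP df dg.
have -> : bcomp f g =
    \sum_(A in monomials f) [ffun x => \prod_(i <- enum A) g i x].
  apply/ffunP => x; rewrite ffunE bfun_zhegalkin sum_ffunE.
  apply: eq_bigr => A _; rewrite ffunE big_enum.
  by apply: eq_bigr => i _; rewrite ffunE.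
apply: deg_sum_le => A /df dA; apply: leq_trans (deg_prod_le _ dg) _.
by rewrite -cardE leq_mul2r dA orbT.
Qed.

Lemma deg_proj n (i : 'I_n) : (deg (proj i) <= 1)%N.
Proof.
have := deg_monomial [set i]%SET; rewrite cards1; congr (deg _ <= _)%N.
by apply/ffunP => x; rewrite !ffunE big_set1.
Qed.

Lemma deg_le0 n (f : bfun n) (x : bvec n) :
  (deg f <= 0)%N -> f x = f [ffun=> false].
Proof.
move=> /deg_leP df; rewrite 2!bfun_zhegalkin; apply: eq_bigr => A /df.
by rewrite leqn0 cards_eq0 => /eqP->; rewrite !big_set0.
Qed.

(** * The operator [delta] and its link with the characteristic rank *)

Definition negv n (x : bvec n) : bvec n := [ffun i => ~~ x i].

Definition delta n (f : bfun n) : bfun n := [ffun x => f x + f (negv x)].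

Lemma negvK n : involutive (@negv n).
Proof. by move=> x; apply/ffunP => i; rewrite !ffunE negbK. Qed.

Lemma negv0 n : negv [ffun=> false] = [ffun=> true] :> bvec n.
Proof. by apply/ffunP => i; rewrite !ffunE. Qed.

Lemma deltaD n (f g : bfun n) : delta (f + g) = delta f + delta g.
Proof. by apply/ffunP => x; rewrite !ffunE addrACA. Qed.

Lemma delta0 n : delta (0 : bfun n) = 0.
Proof. by apply/ffunP => x; rewrite !ffunE. Qed.

Lemma delta_delta n (f : bfun n) : delta (delta f) = 0.
Proof.
apply/ffunP => x; rewrite !ffunE negvK.
by case: (f x); case: (f _).
Qed.

(** Over GF(2) negation is adding 1; expanding the product selects a subset [B] of [A]. *)
Lemma prod_addr1 n (A : {set 'I_n}) (x : bvec n) :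
  \prod_(i in A) ~~ x i = \sum_(B : {set _} | B \subset A) \prod_(i in B) x i.
Proof.
transitivity (\prod_i ((i \in A) * x i + (1 : bool))).
  rewrite big_mkcond /=; apply: eq_bigr => i _.
  by case: (i \in A); case: (x i).
rewrite bigA_distr [RHS]big_mkcond; apply: eq_bigr => B _.
have [/fintype.subsetP sBA|/fintype.subsetPn[i iB iA]] := boolP (B \subset A).
  rewrite [RHS]big_mkcond; apply: eq_bigr => i _.
  by case: ifP => // /sBA ->; rewrite mul1r.
by rewrite (bigD1 i) //= iB (negbTE iA) !mul0r.
Qed.

Lemma sum1_odd (I : finType) (P : pred I) : \sum_(i | P i) (1 : bool) = odd #|P|.
Proof.
rewrite -sum1_card; elim/big_rec2: _ => // i y1 y2 _ ->.
by rewrite oddD.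
Qed.

(* The coefficient of [S] in [f o negv] counts all monomials containing [S];
   adding [f] removes [S] itself. *)
Lemma mem_monomials_delta n (f : bfun n) (S : {set 'I_n}) :
  (S \in monomials (delta f)) = ch S f.
Proof.
suff -> : delta f = zhegalkin (finset (fun S => ch S f)).
  by rewrite monomials_zhegalkin inE.
apply/ffunP => x; rewrite zhegalkinE ffunE 2!bfun_zhegalkin.
under [X in _ + X]eq_bigr => A _.
  under eq_bigr => i _ do rewrite ffunE.
  rewrite prod_addr1; over.
rewrite (exchange_big_dep predT) //= big_mkcond -big_split.
apply: eq_bigr => B _ /=; rewrite inE; set c := \prod_(i in B) x i.
transitivity ((\sum_(A | (A \in monomials f) && (B \proper A)) (1 : bool)) * c).
  rewrite big_distrl [in RHS]big_mkcond [X in _ + X]big_mkcond.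
  rewrite (bigD1 B) // [RHS](bigD1 B) //= subxx fintype.properxx andbT andbF add0r addrA.
  rewrite addr_self add0r; apply: eq_bigr => A neAB.
  by rewrite finset.properEneq eq_sym neAB mul1r.
rewrite sum1_odd /ch; congr (odd _ * _); apply: eq_card => A.
by rewrite inE.
Qed.

(** The shift by one arises because [chi] is the first size from which characteristics vanish, while
    [deg] is the largest size at which one survives. *)
Lemma chi_leE n (f : bfun n) (k : nat) : (chi f <= k.+1)%N = (deg (delta f) <= k)%N.
Proof.
rewrite /chi; case: ex_minnP => m /forallP/= vm minm; apply/idP/deg_leP.
  move=> lemk S; rewrite mem_monomials_delta leqNgt; apply: contraTN => ltkS.
  by have /implyP := vm S; apply; apply: leq_trans lemk ltkS.
move=> dk; apply: minm; apply/forallP => S; apply/implyP => ltkS.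
by apply: contraTN ltkS; rewrite -mem_monomials_delta -leqNgt => /dk.
Qed.

(** A set of odd characteristic lies properly inside some monomial of [f]. *)
Lemma deg_delta_le n (f : bfun n) (d : nat) :
  (deg f <= d.+1)%N -> (deg (delta f) <= d)%N.
Proof.
move=> /deg_leP df; apply/deg_leP => S; rewrite mem_monomials_delta.
rewrite leqNgt; apply: contraTN => ltdS; rewrite /ch (_ : #|_| = 0)%N //.
apply: eq_card0 => A; rewrite inE; apply/negP => /andP[/df dA /proper_card ltSA].
by have := leq_trans ltSA dA; rewrite ltnNge ltdS.
Qed.

Lemma delta_at0 n (f : bfun n) :
  delta f [ffun=> false] = f [ffun=> false] + f [ffun=> true].
Proof. by rewrite ffunE negv0. Qed.

(** * Spaces of functions closed under sums and minors *)

Definition minor n m (s : 'I_n -> 'I_m) (f : bfun n) : bfun m :=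
  [ffun x : bvec m => f [ffun i => x (s i)]].

Lemma minorD n m (s : 'I_n -> 'I_m) (f g : bfun n) :
  minor s (f + g) = minor s f + minor s g.
Proof. by apply/ffunP => x; rewrite !ffunE. Qed.

Lemma delta_minor n m (s : 'I_n -> 'I_m) (f : bfun n) :
  delta (minor s f) = minor s (delta f).
Proof.
apply/ffunP => x; rewrite !ffunE; congr (_ + f _).
by apply/ffunP => i; rewrite !ffunE.
Qed.

Lemma minor_const n m (s : 'I_n -> 'I_m) (f : bfun n) (a : bool) :
  minor s f [ffun=> a] = f [ffun=> a].
Proof. by rewrite ffunE; congr (f _); apply/ffunP => i; rewrite !ffunE. Qed.

Record minor_space (V : forall n, bfun n.+1 -> Prop) : Prop := MinorSpace {
  minor_space0 : forall n, V n 0;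
  minor_spaceD : forall n (f g : bfun n.+1), V n f -> V n g -> V n (f + g);
  minor_spaceM : forall n m (s : 'I_n.+1 -> 'I_m.+1) (f : bfun n.+1),
    V n f -> V m (minor s f) }.

Definition delta_space (V : forall n, bfun n.+1 -> Prop) n (g : bfun n.+1) : Prop :=
  exists2 f, V n f & g = delta f.

(** Stated as a lower bound because the degrees in [V] need not have a maximum. *)
Definition reaches (V : forall n, bfun n.+1 -> Prop) (d : nat) : Prop :=
  exists n (f : bfun n.+1), V n f /\ (d <= deg f)%N.

Section MinorSpace.

Variable V : forall n, bfun n.+1 -> Prop.
Arguments V [n] _.
Hypothesis mV : minor_space V.

Lemma minor_space_sum n (I : Type) (r : seq I) (P : pred I) (F : I -> bfun n.+1) :
  (forall i, P i -> V (F i)) -> V (\sum_(i <- r | P i) F i).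
Proof.
move=> VF; elim/big_rec: _ => [|i f Pi Vf]; first exact: minor_space0.
by apply: minor_spaceD => //; apply: VF.
Qed.

Lemma minor_space_delta : minor_space (delta_space V).
Proof.
split=> [n|n _ _ [f Vf ->] [g Vg ->]|n m s _ [f Vf ->]].
- by exists 0; [exact: minor_space0|rewrite delta0].
- by exists (f + g); [exact: minor_spaceD|rewrite deltaD].
- by exists (minor s f); [exact: minor_spaceM|rewrite delta_minor].
Qed.

(* Summing [f] over all ways of replacing each variable of the maximal monomial
   [T] by [x_(t i)] or [x_0], and every other variable by [x_0], cancels every
   monomial that does not contain [T]. *)
Lemma minor_space_top_product n m (f : bfun n.+1) (T : {set 'I_n.+1})
    (t : 'I_n.+1 -> 'I_m.+1) :
  V f -> T \in monomials f -> deg f = #|T| ->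
  V [ffun x : bvec m.+1 => \prod_(i in T) (x (t i) + x ord0)].
Proof.
move=> Vf Tf degf.
pose s (J : {set 'I_n.+1}) i := if i \in J then t i else ord0.
suff -> : [ffun x : bvec m.+1 => \prod_(i in T) (x (t i) + x ord0)] =
    \sum_(J : {set _} | J \subset T) minor (s J) f.
  by apply: minor_space_sum => J _; apply: minor_spaceM.
apply/ffunP => x; rewrite ffunE sum_ffunE.
transitivity (\sum_(A in monomials f) \sum_(J : {set _} | J \subset T)
   \prod_(i in A) x (s J i)); last first.
  rewrite exchange_big; apply: eq_bigr => J _; rewrite ffunE bfun_zhegalkin.
  by apply: eq_bigr => A _; apply: eq_bigr => i _; rewrite ffunE.
have inner A : \sum_(J : {set _} | J \subset T) \prod_(i in A) x (s J i) =
    \prod_i ((i \in T) * (if i \in A then x (t i) else 1) +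
             (if i \in A then x ord0 else 1)).
  rewrite bigA_distr big_mkcond; apply: eq_bigr => J _.
  have [/fintype.subsetP sJT|/fintype.subsetPn[i iJ iT]] := boolP (J \subset T).
    rewrite [LHS]big_mkcond; apply: eq_bigr => i _; rewrite /s.
    by case: (boolP (i \in J)) => [/sJT ->|_]; rewrite ?mul1r.
  by rewrite (bigD1 i) //= iJ (negbTE iT) !mul0r.
rewrite (bigD1 T) //= inner [X in _ + X]big1 ?addr0.
  rewrite big_mkcond; apply: eq_bigr => i _.
  by case: (i \in T); rewrite ?mul1r // mul0r add0r.
move=> A /andP[Af neAT]; rewrite inner.
have /fintype.subsetPn[i iT iA] : ~~ (T \subset A).
  apply: contra neAT => sTA; rewrite eq_sym eqEcard sTA -degf.
  by move/deg_leP: (leqnn (deg f)); apply.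
by rewrite (bigD1 i) //= iT (negbTE iA) mul1r addr_self mul0r.
Qed.

(** Match the enumerations of [T] and [S] position by position; surplus elements of [T] go to the
    default [s0], which lies in [S]. *)
Lemma surj_of_card_le n m (T : {set 'I_n}) (S : {set 'I_m}) :
  (0 < #|S| <= #|T|)%N -> exists t : 'I_n -> 'I_m, t @: T = S.
Proof.
case/andP => /card_gt0P[s0 s0S] leST.
exists (fun i => nth s0 (enum S) (index i (enum T))).
apply/setP => s; apply/imsetP/idP => [[i iT ->]|sS].
  have [lt|ge] := ltnP (index i (enum T)) (size (enum S)).
    by rewrite -mem_enum mem_nth.
  by rewrite nth_default.
have lt : (index s (enum S) < size (enum T))%N.
  by rewrite -cardE (leq_trans _ leST) // cardE index_mem mem_enum.
have [i0 i0T] : exists i, i \in T.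
  by apply/card_gt0P; apply: leq_trans leST; apply/card_gt0P; exists s0.
exists (nth i0 (enum T) (index s (enum S))); first by rewrite -mem_enum mem_nth.
by rewrite index_uniq ?enum_uniq // nth_index // mem_enum.
Qed.

(** Map a monomial of maximal size onto [S]; factors that become equal collapse by idempotency.
    Nonempty [S] is essential, since the empty product is the constant 1. *)
Lemma minor_space_product n m (f : bfun n.+1) (S : {set 'I_m.+1}) :
  V f -> (0 < #|S| <= deg f)%N ->
  V [ffun x : bvec m.+1 => \prod_(i in S) (x i + x ord0)].
Proof.
move=> Vf /andP[S0 Sf].
have : (0 < #|monomials f|)%N.
  rewrite lt0n; apply/negP => /eqP f0; move: (leq_trans S0 Sf).
  by rewrite /deg (cards0_eq f0) big_set0.
case/(eq_bigmax_cond (fun T : {set 'I_n.+1} => #|T|)) => T Tf degf.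
have [t tT] : exists t : 'I_n.+1 -> 'I_m.+1, t @: T = S.
  by apply: surj_of_card_le; rewrite S0 -degf.
have := minor_space_top_product t Vf Tf degf; congr (V _).
apply/ffunP => x; rewrite !ffunE -tT !prod_boolE.
apply/forall_inP/forall_inP => [h _ /imsetP[i iT ->]|h i iT]; first exact: h.
by apply: h; apply: imset_f.
Qed.

(* If [h = h o negv], then [h x = h (x + x_0 (1,...,1))], which expands [h] as a
   combination of products of the [x_i + x_0]. *)
Lemma minor_space_negv_invariant_mem m (h : bfun m.+1) :
  reaches V (deg h) -> delta h = 0 -> h [ffun=> false] = false -> V h.
Proof.
move=> [n [f [Vf df]]] dh h0.
suff -> : h = \sum_(S in monomials h)
    [ffun x : bvec m.+1 => \prod_(i in S) (x i + x ord0)].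
  apply: minor_space_sum => S Sh; apply: (minor_space_product Vf).
  rewrite (leq_trans _ df) ?andbT; last by move/deg_leP: (leqnn (deg h)); apply.
  rewrite lt0n cards_eq0; apply/eqP => S0.
  by have := set0_in_monomials h; rewrite h0 -S0 Sh.
apply/ffunP => x; rewrite sum_ffunE.
transitivity (h [ffun i => x i + x ord0]); last first.
  rewrite bfun_zhegalkin; apply: eq_bigr => S _; rewrite ffunE.
  by apply: eq_bigr => i _; rewrite ffunE.
have [x0|x0] := boolP (x ord0); last first.
  by congr (h _); apply/ffunP => i; rewrite ffunE addr0.
have -> : [ffun i => x i + true] = negv x.
  by apply/ffunP => i; rewrite !ffunE; case: (x i).
have /ffunP/(_ x) := dh; rewrite !ffunE.
by case: (h x); case: (h _).
Qed.

End MinorSpace.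

(** Membership splits into two degree tests. The test on [delta f] yields [g] in [V] with
    [delta g = delta f]; then [f + g] is invariant under [negv], and the test on its degree puts it
    in [V]. *)
Lemma minor_space_mem (V : forall n, bfun n.+1 -> Prop) n (f : bfun n.+1) :
  minor_space V ->
  f [ffun=> false] = false -> f [ffun=> true] = false ->
  (forall n (g : bfun n.+1), V n g -> g [ffun=> false] = false) ->
  (forall g, V n g -> reaches V (deg (f + g))) ->
  reaches (delta_space V) (deg (delta f)) -> V n f.
Proof.
move=> mV f0 f1 V0 degV degdV.
have [g Vg eqd] : delta_space V (delta f).
  apply: minor_space_negv_invariant_mem => //; first exact: minor_space_delta.
    exact: delta_delta.
  by rewrite delta_at0 f0 f1.
rewrite -(bfun_addfK g f); apply: minor_spaceD => //.
apply: minor_space_negv_invariant_mem => //; first exact: degV.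
  by rewrite deltaD eqd bfun_addff.
by rewrite ffunE f0 (V0 _ _ Vg).
Qed.

(** * Classification of these spaces by two maximal degrees *)

Inductive rank_class : set boolfun -> Prop :=
| RC_Omega : rank_class Omega
| RC_D k : (1 <= k)%N -> rank_class (D k)
| RC_X k : (1 <= k)%N -> rank_class (X k)
| RC_DX i j : (1 <= j < i)%N -> rank_class (D i `&` X j)%classic.

Lemma reaches_bounded (V : forall n, bfun n.+1 -> Prop) : minor_space V ->
  (forall d, reaches V d) \/
  exists d, reaches V d /\ forall n (f : bfun n.+1), V n f -> (deg f <= d)%N.
Proof.
move=> mV; have [allV|] := EM (forall d, reaches V d); first by left.
move/existsNP => [d notV]; right.
(* Descend from an unreached degree to the largest reached one; the zero function reaches 0. *)
elim: d notV => [|d IHd] notV.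
  by case: notV; exists 0%N, 0; split=> //; apply: minor_space0.
have [Vd|/IHd//] := EM (reaches V d); exists d; split=> // n f Vf.
by rewrite leqNgt; apply/negP => ltd; apply: notV; exists n, f.
Qed.

Lemma minor_space_rank_class (V : forall n, bfun n.+1 -> Prop) :
  minor_space V ->
  (forall n (f : bfun n.+1), V n f ->
     f [ffun=> false] = false /\ f [ffun=> true] = false) ->
  (forall n (f : bfun n.+1), V n f -> f = 0) \/
  exists2 Q, rank_class Q & forall n (f : bfun n.+1), V n f <->
    [/\ f [ffun=> false] = false, f [ffun=> true] = false & Q (Bf f)].
Proof.
move=> mV V00.
have memV n (f : bfun n.+1) : f [ffun=> false] = false -> f [ffun=> true] = false ->
    (forall g, V n g -> reaches V (deg (f + g))) ->
    reaches (delta_space V) (deg (delta f)) -> V n f.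
  by move=> f0 f1; apply: minor_space_mem => // m g /V00[].
have reachesW W d e : reaches W d -> (e <= d)%N -> reaches W e.
  by move=> [n [f [Wf df]]] led; exists n, f; split=> //; apply: leq_trans df.
have inV Q n (f : bfun n.+1) : (V n f -> Q) ->
    (f [ffun=> false] = false -> f [ffun=> true] = false -> Q -> V n f) ->
    V n f <-> [/\ f [ffun=> false] = false, f [ffun=> true] = false & Q].
  by move=> VQ QV; split=> [Vf|[]//]; have [f0 f1] := V00 _ _ Vf; split; auto.
have [rV|[d [rVd leVd]]] := reaches_bounded mV;
have [rdV|[e [rdVe ledVe]]] := reaches_bounded (minor_space_delta mV).
- right; exists Omega; first exact: RC_Omega.
  by move=> n f; apply: inV => // f0 f1 _; apply: memV.
- right; exists (X e.+1); first exact: RC_X.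
  move=> n f; rewrite /X /= chi_leE; apply: inV => [Vf|f0 f1 df].
    by apply: ledVe; exists f.
  by apply: memV => //; apply: reachesW df.
(* Impossible case: [delta] does not raise degrees, so a bound on [V] also bounds its image. *)
- have [n [_ [[f Vf ->] ltd]]] := rdV d.+1.
  have := deg_delta_le (leqW (leVd _ _ Vf)).
  by rewrite leqNgt ltd.
(* Maximal degree 0 leaves only constants, and these vanish at the zero tuple. *)
case: d => [|d] in rVd leVd *.
  left=> n f Vf; apply/ffunP => x; rewrite ffunE deg_le0; last exact: leVd.
  by have [] := V00 _ _ Vf.
have degV n (f g : bfun n.+1) : (deg f <= d.+1)%N -> V n g -> reaches V (deg (f + g)).
  by move=> df Vg; apply: reachesW (rVd) _; apply: degD_le => //; apply: leVd.
(* If [d <= e], the bound [d.+1] on the degree already implies the bound [e] on [delta], so no class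
   [X] is required. *)
right; have [lede|lted] := leqP d e.
  exists (D d.+1); first exact: RC_D.
  move=> n f; apply: inV => [/leVd //|f0 f1 df].
  apply: memV => // [g|]; first exact: degV.
  by apply: reachesW rdVe _; apply: leq_trans lede; apply: deg_delta_le.
exists (D d.+1 `&` X e.+1)%classic; first by apply: RC_DX.
move=> n f; apply: inV => [Vf|f0 f1 []].
  by split; [exact: leVd|rewrite /X /= chi_leE; apply: ledVe; exists f].
rewrite /X /= chi_leE => df de.
by apply: memV => // [g|]; [exact: degV|exact: reachesW de].
Qed.

(** Allows the unary function with prescribed end values to be added without leaving [Q]. *)
Lemma rank_class_deg1 Q n (f : bfun n.+1) :
  rank_class Q -> (deg f <= 1)%N -> Q (Bf f).
Proof.
move=> rQ df; have DXf k : (1 <= k)%N -> D k (Bf f) /\ X k (Bf f).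
  case: k => // k _; split; first exact: leq_trans df _.
  by rewrite /X /= chi_leE; apply: leq_trans (deg_delta_le df) _.
case: rQ => [//|k /DXf[]//|k /DXf[]//|i j /andP[j1 ltji]].
by split; [case: (DXf i (leq_trans j1 (ltnW ltji)))|case: (DXf j j1)].
Qed.

Lemma rank_classD Q n (f g : bfun n.+1) :
  rank_class Q -> Q (Bf f) -> Q (Bf g) -> Q (Bf (f + g)).
Proof.
have XD k : (1 <= k)%N -> X k (Bf f) -> X k (Bf g) -> X k (Bf (f + g)).
  by case: k => // k _; rewrite /X /= !chi_leE deltaD; apply: degD_le.
case=> [//|k _|k /XD//|i j /andP[/XD XDj _] [Df Xf] [Dg Xg]].
  exact: degD_le.
by split; [exact: degD_le|exact: XDj].
Qed.

(** * Conditions on the values at the two constant tuples *)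

Inductive end_class : set boolfun -> Prop :=
| EC_Omega : end_class Omega
| EC_l a : end_class (Omega_l a)
| EC_r b : end_class (Omega_r b)
| EC_approx r : end_class (Omega_approx r)
| EC_lr a b : end_class (Omega_lr a b).

Lemma rank_end_listed Q S :
  rank_class Q -> end_class S -> listed_class (Q `&` S)%classic.
Proof.
by case=> [|k k1|k k1|i j ij]; case=> *; rewrite /Omega ?setTI ?setIT; constructor.
Qed.

(** A constant has equal end values, so each end condition becomes void, contradictory, or a choice
    of the constant. *)
Lemma D0_end_listed S : end_class S -> listed_class (D 0 `&` S)%classic.
Proof.
have D0E f : D 0 f -> at_zeros f = at_ones f.
  by case: f => n f df; rewrite /at_zeros /at_ones /= [RHS]deg_le0.
case=> [|a|b|[]|a b].
- by rewrite /Omega setIT; constructor.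
- exact: LC_D0_l.
- rewrite (_ : (_ `&` _)%classic = (D 0 `&` Omega_l b)%classic).
    exact: LC_D0_l.
  by apply/predeqP => f; split=> -[Df <-]; split=> //; rewrite /Omega_l /= D0E.
- rewrite (_ : (_ `&` _)%classic = D 0); first exact: LC_D0.
  by apply/predeqP => f; split=> [[]//|Df]; split=> //; exact: D0E.
- rewrite (_ : (_ `&` _)%classic = classical_sets.set0); first exact: LC_empty.
  by apply/predeqP => f; split=> // -[/D0E e]; apply.
have [->|neab] := eqVneq a b.
  rewrite (_ : (_ `&` _)%classic = (D 0 `&` Omega_l b)%classic).
    exact: LC_D0_l.
  apply/predeqP => f; split=> [[Df []]//|[Df fb]]; split=> //; split=> //.
  by rewrite /Omega_r /= -D0E.
rewrite (_ : (_ `&` _)%classic = classical_sets.set0); first exact: LC_empty.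
apply/predeqP => f; split=> // -[/D0E e [fa fb]]; move: neab.
by rewrite -fa -fb e eqxx.
Qed.

(** A nonempty subset of the plane over GF(2) closed under triple sums is affine: a point, a line or
    the whole plane. The lines are those of [Omega_l], [Omega_r] and [Omega_approx]. *)
Lemma end_class_of_affine (A : bool -> bool -> Prop) a0 b0 :
  A a0 b0 ->
  (forall a b c d e f, A a b -> A c d -> A e f -> A (a + c + e) (b + d + f)) ->
  exists2 S, end_class S & forall f, S f <-> A (at_zeros f) (at_ones f).
Proof.
move=> A0 Aadd.
(* Any three points of the plane sum to the fourth. *)
have A123 : A a0 (~~ b0) -> A (~~ a0) b0 -> A (~~ a0) (~~ b0).
  by move=> A1 A2; have := Aadd _ _ _ _ _ _ A0 A1 A2; case: (a0); case: (b0).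
have A132 : A a0 (~~ b0) -> A (~~ a0) (~~ b0) -> A (~~ a0) b0.
  by move=> A1 A3; have := Aadd _ _ _ _ _ _ A0 A1 A3; case: (a0); case: (b0).
have A231 : A (~~ a0) b0 -> A (~~ a0) (~~ b0) -> A a0 (~~ b0).
  by move=> A2 A3; have := Aadd _ _ _ _ _ _ A0 A2 A3; case: (a0); case: (b0).
have [A1|A1] := EM (A a0 (~~ b0)); have [A2|A2] := EM (A (~~ a0) b0);
have [A3|A3] := EM (A (~~ a0) (~~ b0)).
(* This removes the cases with exactly three points. *)
all: try by exfalso; auto.
- exists Omega; first exact: EC_Omega.
  move=> f; split=> // _; move: A0 A1 A2 A3.
  by case: (a0); case: (b0); case: (at_zeros f); case: (at_ones f).
- exists (Omega_l a0); first exact: EC_l.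
  move=> f; rewrite /Omega_l /=; move: A0 A1 A2 A3.
  by case: (a0); case: (b0); case: (at_zeros f); case: (at_ones f).
- exists (Omega_r b0); first exact: EC_r.
  move=> f; rewrite /Omega_r /=; move: A0 A1 A2 A3.
  by case: (a0); case: (b0); case: (at_zeros f); case: (at_ones f).
- exists (Omega_approx (if a0 == b0 then ApproxEq else ApproxNeq)); first exact: EC_approx.
  move=> f; move: A0 A1 A2 A3; case: (a0); case: (b0);
  rewrite /Omega_approx /= /Omega_eq /Omega_neq /=;
  by case: (at_zeros f); case: (at_ones f).
- exists (Omega_lr a0 b0); first exact: EC_lr.
  move=> f; rewrite /Omega_lr /setI /Omega_l /Omega_r /=; move: A0 A1 A2 A3.
  case: (a0); case: (b0); case: (at_zeros f); case: (at_ones f) => // A0 A1 A2 A3;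
  by split=> // -[].
Qed.

(** * From stability to minors, triple sums and a space of differences *)

Lemma deg_cst n (a : bool) : (deg [ffun _ : bvec n => a] <= 0)%N.
Proof.
case: a; last first.
  by rewrite (_ : [ffun=> false] = 0) ?deg0 //; apply/ffunP => x; rewrite !ffunE.
have := deg_monomial (finset.set0 : {set 'I_n}); rewrite cards0.
by congr (deg _ <= _)%N; apply/ffunP => x; rewrite !ffunE big_set0.
Qed.

Lemma bcomp_proj n m (s : 'I_n -> 'I_m) (f : bfun n) :
  bcomp f (fun i => proj (s i)) = minor s f.
Proof.
by apply/ffunP => x; rewrite !ffunE; congr (f _); apply/ffunP => i; rewrite !ffunE.
Qed.

Lemma Ic_sub_Lc : (Ic `<=` Lc)%classic.
Proof.
move=> _ [n [i ->]]; split; first exact: deg_proj.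
by split; rewrite /Omega_l /Omega_r /= /at_zeros /at_ones /= !ffunE.
Qed.

Lemma stable_Ic_Lc K : stable Lc K -> stable2 Ic Lc K.
Proof.
move=> [KL LK]; split=> // _ [n [m [f [g [Kf Ig ->]]]]].
by apply: KL; exists n, m, f, g; split=> // i; apply: Ic_sub_Lc.
Qed.

Definition unary_fun (a b : bool) n : bfun n.+1 :=
  [ffun x : bvec n.+1 => if x ord0 then b else a].

(** Identifying all variables keeps exactly the two end values. *)
Lemma minor_unary n m (f : bfun n.+1) :
  minor (fun=> ord0) f
    = unary_fun (f [ffun=> false]) (f [ffun=> true]) m.
Proof.
apply/ffunP => x; rewrite !ffunE.
by case: (x ord0); congr (f _); apply/ffunP => i; rewrite !ffunE.
Qed.

Lemma deg_unary_fun a b n : (deg (unary_fun a b n) <= 1)%N.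
Proof.
rewrite -[1%N]mul1n.
rewrite (_ : unary_fun a b n = minor (fun=> ord0) (unary_fun a b 0)).
  rewrite -bcomp_proj; apply: deg_bcomp_le => [|i]; last exact: deg_proj.
  (* In arity one a monomial has at most one variable. *)
  by apply/deg_leP => S _; rewrite -[X in (_ <= X)%N](card_ord 1) max_card.
by apply/ffunP => x; rewrite !ffunE.
Qed.

Section Stable.

Variable K : set boolfun.
Hypothesis stabK : stable2 Ic Lc K.

Lemma stable_minor n m (s : 'I_n.+1 -> 'I_m.+1) (f : bfun n.+1) :
  K (Bf f) -> K (Bf (minor s f)).
Proof.
move=> Kf; apply: stabK.1; exists n, m, f, (fun i => proj (s i)).
by split=> // [i|]; [exists m, (s i)|rewrite bcomp_proj].
Qed.

(** The sum of three variables is linear and idempotent, hence an outer function in [Lc]. *)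
Lemma stable_add3 n (f g h : bfun n.+1) :
  K (Bf f) -> K (Bf g) -> K (Bf h) -> K (Bf (f + g + h)).
Proof.
move=> Kf Kg Kh; apply: stabK.2.
exists 2%N, n, (\sum_(i < 3) proj i), (fun i => nth f [:: f; g; h] i); split.
- split; first by apply: deg_sum_le => i _; apply: deg_proj.
  by split; rewrite /Omega_l /Omega_r /= /at_zeros /at_ones /= sum_ffunE
                    !big_ord_recl big_ord0 !ffunE.
- by case=> -[|[|[|//]]] ?.
- congr Bf; apply/ffunP => x; rewrite !ffunE sum_ffunE !big_ord_recl big_ord0.
  by rewrite !ffunE /= addr0 addrA.
Qed.

Definition ends (a b : bool) : Prop :=
  exists n (f : bfun n.+1),
    [/\ K (Bf f), f [ffun=> false] = a & f [ffun=> true] = b].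

(** The direction space of the affine family [K], cut down to functions vanishing at both constant
    tuples. *)
Definition differences n (f : bfun n.+1) : Prop :=
  [/\ f [ffun=> false] = false, f [ffun=> true] = false &
    exists2 g, K (Bf g) & K (Bf (f + g))].

Lemma ends_unary a b n : ends a b -> K (Bf (unary_fun a b n)).
Proof.
by move=> [m [f [Kf <- <-]]]; rewrite -minor_unary; apply: stable_minor.
Qed.

(** Witnesses may have different arities; their unary minors share one and can be added. *)
Lemma ends_affine a b c d e f :
  ends a b -> ends c d -> ends e f -> ends (a + c + e) (b + d + f).
Proof.
move=> /ends_unary Kab /ends_unary Kcd /ends_unary Kef.
exists 0%N, (unary_fun a b 0 + unary_fun c d 0 + unary_fun e f 0).
by split; rewrite ?ffunE //; apply: stable_add3.
Qed.

Lemma differences_minor_space a b : ends a b -> minor_space differences.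
Proof.
move=> /ends_unary Kab; split=> [n|n f g [f0 f1 [k Kk Kfk]] [g0 g1 [l Kl Kgl]]|].
- split; rewrite ?ffunE //.
  by exists (unary_fun a b n); rewrite ?add0r.
- split; rewrite ?ffunE ?f0 ?g0 ?f1 ?g1 //; exists k => //.
  (* A sum of the three members [f + k], [g + l] and [l] of [K]. *)
  have -> : f + g + k = f + k + (g + l) + l; last exact: stable_add3.
  by rewrite -[RHS]addrA bfun_addfK addrAC.
- move=> n m s f [f0 f1 [k Kk Kfk]]; split; rewrite ?minor_const //.
  by exists (minor s k); rewrite -?minorD; apply: stable_minor.
Qed.

Lemma stable_decomp n (f : bfun n.+1) :
  let a := f [ffun=> false] in let b := f [ffun=> true] in
  K (Bf f) <-> ends a b /\ differences (f + unary_fun a b n).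
Proof.
move=> a b; split=> [Kf|[eab [_ _ [g Kg Kfg]]]].
  have eab : ends a b by exists n, f.
  split=> //; split; rewrite ?ffunE ?addr_self //.
  by exists (unary_fun a b n); rewrite ?bfun_addfK //; apply: ends_unary.
(* With [u] the unary function, [u + g + (f + u + g) = f]. *)
have := stable_add3 (ends_unary n eab) Kg Kfg; congr (K (Bf _)).
apply/ffunP => x; rewrite !ffunE.
by case: ifP => _; case: (f x); case: (g x); case: a {eab Kfg}; case: b.
Qed.

End Stable.

Lemma differences_at_ends K n (f : bfun n.+1) :
  differences K f -> f [ffun=> false] = false /\ f [ffun=> true] = false.
Proof. by case. Qed.

Lemma stable_listed (K : set boolfun) : stable2 Ic Lc K -> listed_class K.
Proof.
move=> stabK; have [[[n0 f0] Kf0]|K0] := EM (exists f, K f); last first.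
  rewrite (_ : K = classical_sets.set0); first exact: LC_empty.
  by apply/predeqP => f; split=> // Kf; apply: K0; exists f.
have e0 : ends K (f0 [ffun=> false]) (f0 [ffun=> true]) by exists n0, f0.
have mV := differences_minor_space stabK e0.
have [S eS SE] := end_class_of_affine e0 (ends_affine stabK).
have [V0|[Q rQ VE]] := minor_space_rank_class mV (@differences_at_ends K).
  rewrite (_ : K = (D 0 `&` S)%classic); first exact: D0_end_listed.
  apply/predeqP => -[n f]; rewrite /setI /= SE /at_zeros /at_ones /=.
  rewrite -/(Bf f) (stable_decomp stabK); split=> [[eab /V0 fu]|[df eab]].
    split=> //; rewrite /D /=.
    have ab : f [ffun=> false] = f [ffun=> true].
      (* If [a] and [b] are the end values of [f], then [P] and its minor are binary members of [K]
         reading different variables. Their sum vanishes at both ends, hence everywhere; where only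
         the first variable is true, it equals [b + a]. *)
      pose P := unary_fun (f [ffun=> false]) (f [ffun=> true]) 1.
      have KP : K (Bf P) by apply: ends_unary.
      have KP' := stable_minor stabK (fun=> ord_max) KP.
      have /ffunP/(_ [ffun i => i == ord0]) : P + minor (fun=> ord_max) P = 0.
        apply: V0; split; rewrite ?ffunE ?minor_const ?addr_self //.
        by exists (minor (fun=> ord_max) P); rewrite ?bfun_addfK.
      by rewrite !ffunE /=; case: (f _); case: (f _).
    rewrite (_ : f = [ffun=> f [ffun=> true]]); first exact: deg_cst.
    rewrite -(bfun_addfK (unary_fun (f [ffun=> false]) (f [ffun=> true]) n) f) fu.
    by apply/ffunP => x; rewrite !ffunE !add0r ab !if_same.
  split=> //; rewrite (_ : _ + _ = 0); first exact: minor_space0 mV n.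
  apply/ffunP => x; rewrite !ffunE -(deg_le0 [ffun=> true] df) (deg_le0 x df).
  by rewrite (deg_le0 [ffun=> true] df) if_same addr_self.
rewrite (_ : K = (Q `&` S)%classic); first exact: rank_end_listed.
apply/predeqP => -[n f]; rewrite /setI /= SE /at_zeros /at_ones /=.
rewrite -/(Bf f) (stable_decomp stabK) VE.
set u := unary_fun _ _ _.
(* Since [u] is in [Q], the functions [f] and [f + u] belong to [Q] together. *)
have Qu : Q (Bf u) by apply: rank_class_deg1 (deg_unary_fun _ _ _).
split=> [[eab [_ _ Qfu]]|[Qf eab]]; split=> //.
  by rewrite -(bfun_addfK u f); apply: rank_classD.
split; last exact: rank_classD.
  by rewrite !ffunE addr_self.
by rewrite !ffunE addr_self.
Qed.

(** * Stability of the listed classes *)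

Lemma stable2I C1 C2 K L : stable2 C1 C2 K -> stable2 C1 C2 L ->
  stable2 C1 C2 (K `&` L)%classic.
Proof.
move=> [K1 K2] [L1 L2]; split=> _ [n [m [f [g [Cf Cg ->]]]]].
  by case: Cf => Kf Lf; split; [apply: K1|apply: L1]; exists n, m, f, g.
by split; [apply: K2|apply: L2]; exists n, m, f, g; split=> // i; case: (Cg i).
Qed.

Lemma stableP K :
  (forall n m (f : bfun n.+1) (g : 'I_n.+1 -> bfun m.+1),
     K (Bf f) -> (forall i, Lc (Bf (g i))) -> K (Bf (bcomp f g))) ->
  (forall n m (f : bfun n.+1) (g : 'I_n.+1 -> bfun m.+1),
     Lc (Bf f) -> (forall i, K (Bf (g i))) -> K (Bf (bcomp f g))) ->
  stable Lc K.
Proof.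
by move=> hr hl; split=> _ [n [m [f [g [Cf Cg ->]]]]]; [apply: hr|apply: hl].
Qed.

Lemma stable_Omega : stable Lc Omega.
Proof. by split. Qed.

(** Positive arity guarantees an inner function, which cannot lie in the empty class. *)
Lemma stable_set0 : stable Lc classical_sets.set0.
Proof. by apply: stableP => // n m f g _ /(_ ord0). Qed.

Lemma stable_D k : stable Lc (D k).
Proof.
apply: stableP => n m f g.
  by move=> df Lg; rewrite /D /= -[k]muln1; apply: deg_bcomp_le => // i; case: (Lg i).
by move=> [df _] dg; rewrite /D /= -[k]mul1n; apply: deg_bcomp_le.
Qed.

Lemma Lc_at_zeros n (g : bfun n.+1) : Lc (Bf g) -> g [ffun=> false] = false.
Proof. by case=> _ []. Qed.

Lemma Lc_at_ones n (g : bfun n.+1) : Lc (Bf g) -> g [ffun=> true] = true.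
Proof. by case=> _ []. Qed.

Lemma Lc_cst n (g : bfun n.+1) (a : bool) : Lc (Bf g) -> g [ffun=> a] = a.
Proof. by move=> Lg; case: a; rewrite ?Lc_at_zeros ?Lc_at_ones. Qed.

(** Degree at most 1 and value 0 at the zero tuple leave only singleton monomials. *)
Lemma Lc_add n (g : bfun n.+1) (u v : bvec n.+1) :
  Lc (Bf g) -> g (u + v) = g u + g v.
Proof.
move=> Lg; have [/deg_leP dg _] := Lg.
rewrite !bfun_zhegalkin -big_split; apply: eq_bigr => A Ag.
have : #|A| == 1%N.
  rewrite eqn_leq dg // lt0n cards_eq0; apply/eqP => A0.
  by have := set0_in_monomials g; rewrite (Lc_cst _ Lg) -A0 Ag.
by case/cards1P => i ->; rewrite !big_set1 ffunE.
Qed.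

Lemma negvE n (x : bvec n) : negv x = x + [ffun=> true].
Proof. by apply/ffunP => i; rewrite !ffunE; case: (x i). Qed.

Lemma Lc_negv n (g : bfun n.+1) (x : bvec n.+1) : Lc (Bf g) -> g (negv x) = ~~ g x.
Proof. by move=> Lg; rewrite negvE Lc_add // Lc_cst //; case: (g x). Qed.

Lemma bcomp_Lc_cst n m (f : bfun n.+1) (g : 'I_n.+1 -> bfun m.+1) (a : bool) :
  (forall i, Lc (Bf (g i))) -> bcomp f g [ffun=> a] = f [ffun=> a].
Proof.
by move=> Lg; rewrite ffunE; congr (f _); apply/ffunP => i; rewrite !ffunE Lc_cst.
Qed.

(** Reduces to [stable_D]: [delta] passes through inner functions in [Lc] because they commute with
    [negv], and through an outer one because it is additive. *)
Lemma stable_X k : (1 <= k)%N -> stable Lc (X k).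
Proof.
case: k => // k _; apply: stableP => n m f g; rewrite /X /= chi_leE.
  move=> df Lg; rewrite chi_leE; have := (stable_D k).1 (Bf (bcomp (delta f) g)).
  rewrite /D /= (_ : delta (bcomp f g) = bcomp (delta f) g).
    by apply; exists n, m, (delta f), g.
  apply/ffunP => x; rewrite !ffunE; congr (_ + f _).
  by apply/ffunP => i; rewrite !ffunE Lc_negv.
move=> Lf dg; have := (stable_D k).2 (Bf (bcomp f (fun i => delta (g i)))).
rewrite /D /= (_ : delta (bcomp f g) = bcomp f (fun i => delta (g i))).
  by apply; exists n, m, f, (fun i => delta (g i)); split=> // i; have := dg i; rewrite chi_leE.
apply/ffunP => x; rewrite !ffunE -Lc_add //; congr (f _).
by apply/ffunP => i; rewrite !ffunE.
Qed.

Lemma stable_Omega_l a : stable Lc (Omega_l a).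
Proof.
apply: stableP => n m f g; rewrite /Omega_l /= /at_zeros /=.
  by move=> fa Lg; rewrite bcomp_Lc_cst.
move=> Lf ga; rewrite ffunE -[RHS](Lc_cst a Lf); congr (f _).
by apply/ffunP => i; rewrite !ffunE ga.
Qed.

Lemma stable_Omega_r b : stable Lc (Omega_r b).
Proof.
apply: stableP => n m f g; rewrite /Omega_r /= /at_ones /=.
  by move=> fb Lg; rewrite bcomp_Lc_cst.
move=> Lf gb; rewrite ffunE -[RHS](Lc_cst b Lf); congr (f _).
by apply/ffunP => i; rewrite !ffunE gb.
Qed.

Lemma stable_Omega_approx r : stable Lc (Omega_approx r).
Proof.
case: r; apply: stableP => n m f g;
  rewrite /Omega_approx /Omega_eq /Omega_neq /= /at_zeros /at_ones /=.
- by move=> fe Lg; rewrite !bcomp_Lc_cst.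
- move=> Lf ge; rewrite !ffunE; congr (f _).
  by apply/ffunP => i; rewrite !ffunE ge.
- by move=> fe Lg; rewrite !bcomp_Lc_cst.
- move=> Lf ge; rewrite !ffunE.
  (* Each [g i] has opposite end values, so the two tuples fed to [f] are complementary. *)
  rewrite (_ : [ffun i => g i [ffun=> true]] = negv [ffun i => g i [ffun=> false]]).
    by rewrite Lc_negv //; case: (f _).
  apply/ffunP => i; rewrite !ffunE; have := ge i.
  by case: (g i [ffun=> false]); case: (g i _).
Qed.

Lemma listed_stable (K : set boolfun) : listed_class K -> stable Lc K.
Proof.
have lr a b : stable Lc (Omega_lr a b).
  exact: stable2I (stable_Omega_l a) (stable_Omega_r b).
have ij i j : (1 <= j < i)%N -> stable Lc (D i `&` X j)%classic.
  by move=> /andP[j1 _]; apply: stable2I (stable_D i) (stable_X j1).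
case=> *; repeat first [exact: stable_Omega | exact: stable_set0 | exact: lr
  | exact: stable_Omega_l | exact: stable_Omega_r | exact: stable_Omega_approx
  | exact: stable_D | exact: stable_X | exact: ij | apply: stable2I].
Qed.

Theorem theorem6p1 (K : set boolfun) :
  (stable Lc K <-> listed_class K) /\ (stable2 Ic Lc K <-> listed_class K).
Proof.
(* The equivalences close a cycle: [Lc]-stable, then stable for [Ic] and [Lc], then listed, then
   [Lc]-stable again. *)
have LS := @listed_stable K; have SL := @stable_listed K.
have st := @stable_Ic_Lc K.
by split; split=> ?; auto.
Qed.
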